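(* Let $T:[0,1]\to[0,1]$ be one of the following two maps. (System I) $T(x)=\gamma x \bmod 1$, where $\gamma>1$ is an integer. (System II) the Gauss map $T(0)=0$ and $T(x)=\frac1x \bmod 1$ for $x\in(0,1]$. Let $(f_n)_{n\ge 1}$ be any equicontinuous sequence of functions $f_n:[0,1]\to[0,1]$. Then the set $$\mathfrak{BA}\left((f_n)_n\right)=\left\{x\in[0,1]:\ \liminf_{n\to\infty}|T^n x-f_n(x)|>0\right\}$$ is $\beta$-absolute winning (in McMullen's game played on $[0,1]$) for every $\beta\in\left(0,\frac13\right)$.
   Context: Here $y \bmod 1$ denotes the fractional part of $y$ in $[0,1)$, and $T^n$ is the $n$-fold iterate of $T$. The space $X=[0,1]$ carries the usual Euclidean distance $d(x,y)=|x-y|$. For $(z,\rho)\in X\times(0,\infty)$ the closed ball is $B(z,\rho)=\{x\in X: d(z,x)\le\rho\}$. McMullen's (absolute) game on $X$ with parameter $\beta\in(0,1/3)$: two players, Bob and Alice, alternately choose pairs in $X\times(0,\infty)$, with Bob moving first. Bob chooses $(z_1,r_1)$, Alice chooses $(\zeta_1,\rho_1)$, Bob chooses $(z_2,r_2)$, Alice chooses $(\zeta_2,\rho_2)$, and so on, subject for all $k\ge1$ to $$B(z_{k+1},r_{k+1})\subset B(z_k,r_k)\setminus B(\zeta_k,\rho_k),\qquad \rho_k\le\beta r_k,\qquad r_{k+1}\ge\beta r_k .$$ A subset $S\subset X$ is called $\beta$-absolute winning if Alice has a strategy guaranteeing that, however Bob plays, every resulting infinite play satisfies $\bigcap_{k=1}^\infty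 B(z_k,r_k)\cap S\ne\varnothing$. Equicontinuous: for every $x\in[0,1]$ and $\varepsilon>0$ there is $\delta>0$ such that $|f_n(x)-f_n(y)|<\varepsilon$ for all $n$ and all $y\in[0,1]$ with $|x-y|<\delta$. *)

(* Defs.v *)
From mathcomp Require Import all_boot all_order all_algebra.
From mathcomp Require Import all_classical all_reals all_analysis.

Set Implicit Arguments.
Unset Strict Implicit.
Unset Printing Implicit Defensive.

Import Order.TTheory GRing.Theory Num.Theory.

Local Open Scope classical_set_scope.
Local Open Scope ring_scope.

Section Maps.
Variable R : realType.

Definition frac_part (y : R) : R := y - (Num.floor y)%:~R.

Definition times_map (gamma : nat) (x : R) : R := frac_part (gamma%:R * x).

Definition gauss_map (x : R) : R := if x == 0 then 0 else frac_part x^-1.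

End Maps.

Section BadlyApproximable.
Variable R : realType.

Definition unit_itv : set R := [set` `[0, 1]].

(* Points of [0,1] are reals in [unit_itv] and sequences (f_n)_{n >= 1} are
   functions of n : nat whose value at n = 0 is unconstrained. *)
Definition maps_unit_itv (f : nat -> R -> R) : Prop :=
  forall n x, (0 < n)%N -> unit_itv x -> unit_itv (f n x).

Definition equicontinuous_unit_itv (f : nat -> R -> R) : Prop :=
  forall x eps, unit_itv x -> 0 < eps ->
  exists2 delta, 0 < delta &
    forall n y, (0 < n)%N -> unit_itv y -> `|x - y| < delta ->
      `|f n x - f n y| < eps.

Definition BA (T : R -> R) (f : nat -> R -> R) : set R :=
  [set x | unit_itv x /\
           (0 < limn_einf (fun n => `|iter n T x - f n x|%:E))%E].

End BadlyApproximable.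

Section AbsoluteGame.
Variable R : realType.

(* A move (z, rho) is the formal pair of a centre and a radius: when part of the
   ball sticks out of [0,1], it is not determined by the set [ball01]. *)
Definition move : Type := (R * R)%type.

Definition is_move (p : move) : Prop := unit_itv p.1 /\ 0 < p.2.

Definition ball01 (p : move) : set R :=
  [set x | unit_itv x /\ `|p.1 - x| <= p.2].

(* In the rules below [b] and [a] are the moves of Bob and Alice, counted from
   0, with [a k] played between [b k] and [b k.+1]. *)
Definition bob_rule (beta : R) (b a : nat -> move) (k : nat) : Prop :=
  is_move (b k) /\
  match k with
  | 0%N => True
  | j.+1 => ball01 (b j.+1) `<=` ball01 (b j) `\` ball01 (a j) /\
            beta * (b j).2 <= (b j.+1).2
  end.

Definition alice_rule (beta : R) (b a : nat -> move) (k : nat) : Prop :=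
  is_move (a k) /\ (a k).2 <= beta * (b k).2.

(* A strategy for Alice sees the list of Bob's moves so far, oldest first; her
   own earlier moves are determined by it. *)
Definition replies (sigma : seq move -> move) (b : nat -> move) : nat -> move :=
  fun k => sigma (mkseq b k.+1).

(* Alice has to play legally as long as Bob has done so. The winning condition
   concerns infinite plays only: she does not lose if Bob has no legal move. *)
Definition absolute_winning (beta : R) (S : set R) : Prop :=
  S `<=` @unit_itv R /\
  exists sigma : seq move -> move, forall b : nat -> move,
    (forall k, (forall j, (j <= k)%N -> bob_rule beta b (replies sigma b) j) ->
       alice_rule beta b (replies sigma b) k) /\
    ((forall k, bob_rule beta b (replies sigma b) k) ->
       (\bigcap_k ball01 (b k)) `&` S !=set0).

End AbsoluteGame.

(* Main.v *)
(** Idea.  The moves are grouped in windows of length 2M.  In a window whose first ball has radius r,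
    the preceding window having started from radius r', Alice takes care of the cylinders I (of any
    rank n) with 2r < |I| <= 2r'.  Such an I meeting the ball contains one of its two end points, so I
    belongs to one of two decreasing chains of geometrically decreasing lengths, and there are at most
    cM of them.  In each of them the points with |T^n x - f_n x| < e lie within a short distance of any
    one such point, called a target.  On even moves Alice deletes a neighbourhood of the median of the
    targets still near Bob's ball; Bob has to choose a side, so the number of targets is halved, and
    cM < 2^M moves suffice to get rid of all of them.  On odd moves Alice deletes the rationals one by
    one, which forces the radii to tend to 0 and the limit point to be irrational. *)

Require Import Defs.
From mathcomp Require Import all_boot all_order all_algebra.
From mathcomp Require Import all_classical all_reals all_analysis.
From mathcomp Require Import ring lra zify.

Set Implicit Arguments.
Unset Strict Implicit.
Unset Printing Implicit Defensive.

Import Order.TTheory GRing.Theory Num.Theory.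

Local Open Scope classical_set_scope.
Local Open Scope ring_scope.

(** * Closed balls of [0,1] and decreasing sequences of them *)

Section Balls.
Variable R : realType.
Implicit Types (p : move R) (x y t : R) (b : nat -> move R).

Lemma unit_itvE x : unit_itv x = (0 <= x <= 1).
Proof. by rewrite /unit_itv /= in_itv. Qed.

Lemma ball01_center p : is_move p -> ball01 p p.1.
Proof. by move=> [p1 p2]; split=> //; rewrite subrr normr0 ltW. Qed.

Lemma ball01_convex p x y t :
  ball01 p x -> ball01 p y -> x <= t <= y -> ball01 p t.
Proof.
rewrite /ball01 /= !unit_itvE !ler_norml => -[/andP[x0 x1] /andP[x2 x3]].
move=> [/andP[y0 y1] /andP[y2 y3]] /andP[xt ty].
by split; apply/andP; split; lra.
Qed.

Lemma ball01_left_end p : is_move p -> ~ ball01 p 0 -> ball01 p (p.1 - p.2).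
Proof.
rewrite /is_move /ball01 /= !unit_itvE => -[/andP[p0 p1] r0] nb.
have rp : p.2 < p.1.
  rewrite ltNge; apply/negP => pr; apply: nb; split; first by rewrite lexx ler01.
  by rewrite subr0 ger0_norm.
split; first by apply/andP; split; lra.
by rewrite opprB addrC subrK gtr0_norm.
Qed.

Lemma ball01_nested b j k : (forall i, ball01 (b i.+1) `<=` ball01 (b i)) ->
  (j <= k)%N -> ball01 (b k) `<=` ball01 (b j).
Proof.
move=> bS /subnK <-; elim: (k - j)%N => [|n IH] //.
by rewrite addSn; apply: subset_trans IH.
Qed.

Lemma nested_balls_meet b : (forall k, is_move (b k)) ->
  (forall k, ball01 (b k.+1) `<=` ball01 (b k)) ->
  exists x, forall k, ball01 (b k) x.
Proof.
move=> bm bS.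
pose lo k : R := Num.max 0 ((b k).1 - (b k).2).
have lob k : ball01 (b k) (lo k).
  have [+ r0] := bm k; rewrite /ball01 /= !unit_itvE => /andP[z0 z1].
  by rewrite ler_norml /lo; case: (leP 0 ((b k).1 - (b k).2)) => h; split;
    apply/andP; split; lra.
have lole k y : ball01 (b k) y -> lo k <= y.
  rewrite /ball01 /= !unit_itvE ler_norml => -[/andP[y0 y1] /andP[h1 h2]].
  by rewrite /lo ge_max y0; lra.
have lole2 j k : exists2 y, lo j <= y & ball01 (b k) y.
  exists (b (maxn j k)).1; have bc := ball01_center (bm (maxn j k)).
    by apply: lole; apply: ball01_nested bc => //; exact: leq_maxl.
  by apply: ball01_nested bc => //; exact: leq_maxr.
have E0 : range lo !=set0 by exists (lo 0%N), 0%N.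
have E1 : has_ubound (range lo).
  exists 1 => _ [k _ <-]; have [+ _] := lob k.
  by rewrite unit_itvE => /andP[].
exists (sup (range lo)) => k.
have lox : lo k <= sup (range lo) by apply: ub_le_sup => //; exists k.
pose hi : R := Num.min 1 ((b k).1 + (b k).2).
have hib : ball01 (b k) hi.
  have [+ r0] := bm k; rewrite /ball01 /= !unit_itvE => /andP[z0 z1].
  by rewrite ler_norml /hi; case: (leP 1 ((b k).1 + (b k).2)) => h; split;
    apply/andP; split; lra.
apply: ball01_convex (lob k) hib _; rewrite lox /=.
apply: ge_sup => // _ [j _ <-].
have [y jy [+ ky]] := lole2 j k; rewrite unit_itvE => /andP[y0 y1].
move: ky; rewrite ler_norml => /andP[h1 h2].
by apply: (le_trans jy); rewrite /hi le_min y1; lra.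
Qed.

(** A ball of large radius around a point near [x] covers a rational close to [x] on one side. Once
    0 is avoided, [0,1] does not cut the ball off on the left, so its radius is visible there. *)
Lemma balls_avoiding_rationals b : (forall k, is_move (b k)) ->
  (forall k, ball01 (b k.+1) `<=` ball01 (b k)) ->
  (forall q : rat, exists k, ~ ball01 (b k) (ratr q)) ->
  exists x, [/\ forall k, ball01 (b k) x, irrational x &
    forall e, 0 < e -> exists N, forall k, (N <= k)%N -> (b k).2 < e].
Proof.
move=> bm bS bq.
have [x xb] := nested_balls_meet bm bS.
exists x; split=> //.
  by move=> [q _ qx]; have [k] := bq q; rewrite qx.
move=> e e0.
have bqN q : exists N, forall k, (N <= k)%N -> ~ ball01 (b k) (ratr q).
  have [N qN] := bq q; exists N => k Nk qk; apply: qN.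
  exact: ball01_nested qk.
have [N0] := bqN 0; rewrite rmorph0 => H0.
have /rat_in_itvoo[q1] : x - e / 2 < x by lra.
rewrite in_itv /= => /andP[q11 q12].
have /rat_in_itvoo[q2] : x < x + e / 2 by lra.
rewrite in_itv /= => /andP[q21 q22].
have [N1 H1] := bqN q1; have [N2 H2] := bqN q2.
exists (maxn N0 (maxn N1 N2)) => k; rewrite !geq_max => /and3P[k0 k1 k2].
rewrite ltNge; apply/negP => ek.
have bl := ball01_left_end (bm k) (H0 k k0).
have bc := ball01_center (bm k).
have [xz|zx] := leP x ((b k).1 - e / 2).
  by apply: (H2 k k2); apply: ball01_convex (xb k) bc _; apply/andP; split; lra.
by apply: (H1 k k1); apply: ball01_convex bl (xb k) _; apply/andP; split; lra.
Qed.

End Balls.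

(** * Medians of finite lists *)

Section Median.
Variable R : realType.
Implicit Type s : seq R.

Definition median s : R := nth 0 (sort <=%O s) (size s)./2.

Lemma median_mem s : (0 < size s)%N -> median s \in s.
Proof.
move=> s0; rewrite -(mem_sort <=%O) mem_nth// size_sort.
by rewrite ltn_half_double -addnn -[ltnLHS]addn0 ltn_add2l.
Qed.

Lemma count_lt_median s : (count (< median s) s <= (size s)./2)%N.
Proof.
set m := median s; rewrite -(count_sort <=%O).
have [s0|s0] := posnP (size s).
  by rewrite (leq_trans (count_size _ _))// size_sort s0.
have hs : ((size s)./2 < size (sort <=%O s))%N.
  by rewrite size_sort ltn_half_double -addnn -[ltnLHS]addn0 ltn_add2l.
rewrite -(cat_take_drop (size s)./2 (sort <=%O s)) count_cat.
rewrite (@eq_in_count _ _ pred0 (drop _ _)) ?count_pred0 ?addn0.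
  by rewrite (leq_trans (count_size _ _))// size_take hs.
move=> y /(nthP 0)[i]; rewrite size_drop => ih <- /=.
rewrite nth_drop; apply/negbTE; rewrite -leNgt.
apply: (sorted_leq_nth le_trans le_refl 0 (sort_le_sorted s)) => //.
- by rewrite inE -ltn_subRL.
- exact: leq_addr.
Qed.

Lemma count_gt_median s : (count (> median s) s <= (size s)./2)%N.
Proof.
set m := median s; rewrite -(count_sort <=%O).
have [s0|s0] := posnP (size s).
  by rewrite (leq_trans (count_size _ _))// size_sort s0.
have hs : ((size s)./2 < size (sort <=%O s))%N.
  by rewrite size_sort ltn_half_double -addnn -[ltnLHS]addn0 ltn_add2l.
rewrite -(cat_take_drop (size s)./2.+1 (sort <=%O s)) count_cat.
rewrite (@eq_in_count _ _ pred0 (take _ _)) ?count_pred0 ?add0n.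
  rewrite (leq_trans (count_size _ _))// size_drop size_sort leq_subLR.
  by rewrite addSn addnn -{1}(odd_double_half (size s)) -add1n leq_add2r leq_b1.
move=> y /(nthP 0)[i]; rewrite (size_takel hs) => ih <- /=.
rewrite nth_take//; apply/negbTE; rewrite -leNgt.
apply: (sorted_leq_nth le_trans le_refl 0 (sort_le_sorted s)) => //.
by rewrite inE (leq_trans ih).
Qed.

End Median.

(** * Targets close to a ball *)

Section NearTargets.
Variable R : realType.
Implicit Types (eta : R) (p a : move R) (s : seq R).

Definition near_targets eta p s :=
  [seq t <- s | `[< exists2 x, ball01 p x & `|x - t| <= eta >]].

Lemma near_targetsS eta p p' s : ball01 p `<=` ball01 p' ->
  (size (near_targets eta p s) <= size (near_targets eta p' s))%N.
Proof.
move=> pp'; rewrite !size_filter; apply: sub_count => t /asboolP[x px xt].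
by apply/asboolP; exists x => //; exact: pp'.
Qed.

(* Bob's next ball p' lies on one side of the centre of a, at distance more than eta from it. *)
Lemma near_targets_median eta p p' a s : is_move p' ->
  ball01 p' `<=` ball01 p `\` ball01 a -> eta <= a.2 -> unit_itv a.1 -> 0 < a.2 ->
  (near_targets eta p s <> [::] -> a.1 = median (near_targets eta p s)) ->
  (size (near_targets eta p' s) <= (size (near_targets eta p s))./2)%N.
Proof.
move=> p'm pp' ea a01 a0 am.
have sub : ball01 p' `<=` ball01 p by move=> x /pp'[].
have [s0|sn0] := posnP (size (near_targets eta p s)).
  by have := near_targetsS eta s sub; rewrite s0 leqn0 => /eqP ->.
have {}am : a.1 = median (near_targets eta p s).
  by apply: am => s0; rewrite s0 in sn0.
have aN : ~ ball01 p' a.1.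
  by move=> /pp'[_]; apply; split=> //; rewrite subrr normr0 ltW.
have far x : ball01 p' x -> eta < `|a.1 - x|.
  move=> xp; rewrite (le_lt_trans ea)// ltNge; apply/negP => h.
  by have [_] := pp' _ xp; apply; split=> //; case: xp.
(* A target near the smaller ball is already near the larger one, so counting within the earlier
   list is enough. *)
have E : near_targets eta p' s = near_targets eta p' (near_targets eta p s).
  rewrite /near_targets -filter_predI; apply: eq_filter => t /=.
  case: (asboolP (exists2 x, ball01 p' x & _)) => //= -[x px xt].
  by apply/esym/asboolP; exists x => //; exact: sub.
rewrite {}E; set s' := near_targets eta p s in am *.
have p'c := ball01_center p'm.
(* The ball is convex and misses [a.1], so it lies on the side of its centre, and the targets near
   it lie strictly on that side of the median. *)
have [za|az] := leP p'.1 a.1.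
  apply: leq_trans (count_lt_median s').
  rewrite -am size_filter; apply: sub_count => t /asboolP[x px xt] /=.
  have xa : x < a.1.
    rewrite ltNge; apply/negP => ax; apply: aN.
    by apply: ball01_convex p'c px _; rewrite za ax.
  have := far _ px; rewrite gtr0_norm ?subr_gt0// => xe.
  by move: xt; rewrite ler_norml => /andP[h1 h2]; lra.
apply: leq_trans (count_gt_median s').
rewrite -am size_filter; apply: sub_count => t /asboolP[x px xt] /=.
have xa : a.1 < x.
  rewrite ltNge; apply/negP => ax; apply: aN.
  by apply: ball01_convex px p'c _; rewrite ax ltW.
have := far _ px; rewrite ltr0_norm ?subr_lt0// => xe.
by move: xt; rewrite ler_norml => /andP[h1 h2]; lra.
Qed.

End NearTargets.

(** * Alice's strategy and the plays that follow it *)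

Section Strategy.
Variables (R : realType) (beta : R) (M : nat).
Variable targets : move R -> move R -> seq R.
Implicit Types (b : nat -> move R) (k w : nat).

(* Window w consists of the moves with index in [2Mw, 2M(w+1)[; window 0 plays no role. *)
Definition window_targets b w : seq R :=
  targets (b (w.-1 * M.*2)%N) (b (w * M.*2)%N).

(** At most 4M moves lead from the start of the preceding window to a move of the current one, each
    costing a factor [beta] at worst; the extra factor is Alice's own. She can therefore always
    delete this radius. *)
Definition window_radius b w : R := beta ^+ (4 * M).+1 * (b (w.-1 * M.*2)%N).2.

Definition remaining b k : seq R :=
  near_targets (window_radius b (k %/ M.*2)%N) (b k) (window_targets b (k %/ M.*2)%N).

(** The odd move [k] handles the rational of code [k./2]. With nothing to delete, Bob's centre is a
    legal choice. *)
Definition alice_center b k : R :=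
  if odd k then
    if unpickle k./2 is Some q then
      if 0 <= (ratr q : R) <= 1 then ratr q else (b k).1
    else (b k).1
  else if remaining b k is [::] then (b k).1 else median (remaining b k).

Definition alice_strategy (h : seq (move R)) : move R :=
  let b := nth (0, 0) h in let k := (size h).-1 in
  (alice_center b k, beta * (b k).2).

(** The strategy reads only moves of index at most [k], all present in the history. *)
Lemma replies_alice_strategy b k :
  replies alice_strategy b k = (alice_center b k, beta * (b k).2).
Proof.
rewrite /replies /alice_strategy size_mkseq /=.
have nthb i : (i <= k)%N -> nth (0, 0) (mkseq b k.+1) i = b i.
  by move=> ik; rewrite nth_mkseq.
have wk : (k %/ M.*2 * M.*2 <= k)%N := leq_trunc_div k M.*2.
have wk' : ((k %/ M.*2).-1 * M.*2 <= k)%N.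
  by rewrite (leq_trans _ wk)// leq_mul2r leq_pred orbT.
have remE : remaining (nth (0, 0) (mkseq b k.+1)) k = remaining b k.
  by rewrite /remaining /window_targets /window_radius !nthb.
by rewrite nthb// /alice_center remE nthb.
Qed.

Hypothesis beta_gt0 : 0 < beta.
Hypothesis targets_unit : forall p q t, t \in targets p q -> unit_itv t.

Lemma alice_center_unit b k : is_move (b k) -> unit_itv (alice_center b k).
Proof.
move=> [b01 _]; rewrite /alice_center; case: ifP => _.
  by case: unpickle => // q; case: ifP => //; rewrite unit_itvE.
case E : (remaining b k) => [|t s] //; rewrite -E.
have /median_mem : (0 < size (remaining b k))%N by rewrite E.
by rewrite mem_filter => /andP[_ /targets_unit].
Qed.

Lemma alice_strategy_legal b k : is_move (b k) ->
  alice_rule beta b (replies alice_strategy b) k.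
Proof.
move=> bk; rewrite /alice_rule replies_alice_strategy lexx; split=> //.
by split; [exact: alice_center_unit|case: bk => _ b0; rewrite mulr_gt0].
Qed.

Section Play.
Variable b : nat -> move R.
Hypothesis b_legal : forall k, bob_rule beta b (replies alice_strategy b) k.

Let b_move k : is_move (b k). Proof. by case: (b_legal k). Qed.

Let b_step k : ball01 (b k.+1) `<=`
  ball01 (b k) `\` ball01 (alice_center b k, beta * (b k).2).
Proof. by case: (b_legal k.+1) => _ []; rewrite replies_alice_strategy. Qed.

Let b_nested k : ball01 (b k.+1) `<=` ball01 (b k).
Proof. by move=> x /b_step[]. Qed.

Let b_radius k : beta * (b k).2 <= (b k.+1).2.
Proof. by case: (b_legal k.+1) => _ []. Qed.

Lemma play_radius k n : beta ^+ n * (b k).2 <= (b (k + n)%N).2.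
Proof.
elim: n => [|n IH]; first by rewrite expr0 mul1r addn0.
by rewrite addnS (le_trans _ (b_radius _))// exprS -mulrA ler_pM2l.
Qed.

Lemma play_avoids_rationals (q : rat) : exists k, ~ ball01 (b k) (ratr q).
Proof.
have [q01|q01] := boolP (0 <= (ratr q : R) <= 1); last first.
  by exists 0%N => -[]; rewrite unit_itvE (negbTE q01).
(* The move [(pickle q).*2.+1] deletes [q], so the next ball misses it. *)
exists (pickle q).*2.+2 => /b_step[_]; apply.
have ok : odd (pickle q).*2.+1 by rewrite /= odd_double.
have hk : ((pickle q).*2.+1)./2 = pickle q by rewrite /= uphalf_double.
rewrite /alice_center ok hk pickleK q01.
split; first by rewrite unit_itvE.
by rewrite subrr normr0 mulr_ge0// ltW//; case: (b_move (pickle q).*2.+1).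
Qed.

Hypothesis beta_le1 : beta <= 1.

Lemma window_radius_le w i : (i <= M)%N ->
  window_radius b w.+1 <= beta * (b (w.+1 * M.*2 + i.*2)%N).2.
Proof.
move=> iM; rewrite /window_radius /= exprS -mulrA ler_pM2l//.
have -> : (w.+1 * M.*2 + i.*2 = w * M.*2 + (M.*2 + i.*2))%N.
  by rewrite mulSn [(M.*2 + _)%N]addnC addnA.
apply: le_trans (play_radius _ _); rewrite ler_pM2r; last first.
  by case: (b_move (w * M.*2)%N).
apply: ler_wiXn2l => //; first exact: ltW.
rewrite -doubleD -muln2 mulnC.
by rewrite (@leq_trans (2 * (M + M))) ?leq_pmul2l ?leq_add2l// addnn -mul2n mulnA.
Qed.

(** Of two consecutive moves, the even one halves the list by the median and the odd one can only
    shrink it further. *)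
Lemma remaining_halved w i : (i <= M)%N ->
  (size (near_targets (window_radius b w.+1) (b (w.+1 * M.*2 + i.*2)%N)
           (window_targets b w.+1)) * 2 ^ i <= size (window_targets b w.+1))%N.
Proof.
elim: i => [_|i IH iM].
  by rewrite expn0 muln1 size_filter count_size.
apply: leq_trans (IH (ltnW iM)); rewrite expnS mulnA leq_mul2r.
apply/orP; right; rewrite doubleS !addnS.
set k := (_ + i.*2)%N.
have kw : (k %/ M.*2 = w.+1)%N.
  by rewrite /k divnMDl ?divn_small ?addn0// ?ltn_double// double_gt0 (leq_ltn_trans _ iM).
rewrite muln2 -geq_half_double.
apply: leq_trans (near_targetsS _ _ (@b_nested k.+1)) _.
apply: (near_targets_median (a := (alice_center b k, beta * (b k).2))) => //=.
- by apply: window_radius_le; exact: ltnW.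
- exact: alice_center_unit.
- by rewrite mulr_gt0//; case: (b_move k).
- rewrite /alice_center.
  have -> : odd k = false by rewrite oddD oddM !odd_double andbF.
  by rewrite /remaining kw; case: near_targets.
Qed.

Hypothesis targets_size : forall p q, (size (targets p q) < 2 ^ M)%N.

(** M halvings exhaust fewer than [2 ^ M] targets, whereas a target this close to [x] would stay
    near every ball. *)
Lemma play_avoids_targets x w t : (forall k, ball01 (b k) x) ->
  t \in window_targets b w.+1 -> window_radius b w.+1 < `|x - t|.
Proof.
move=> xb tw; rewrite ltNge; apply/negP => xt.
have := remaining_halved w (leqnn M).
set s := near_targets _ _ _.
have : (0 < size s)%N.
  have : t \in s by rewrite mem_filter tw andbT; apply/asboolP; exists x.
  by case: s.
move=> s0 /leq_ltn_trans/(_ (targets_size _ _)).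
by rewrite ltnNge leq_pmull.
Qed.

End Play.

End Strategy.

(** Separates the game from the dynamics: it remains to choose few targets whose avoidance forces
    [x] into [S]. *)
Lemma absolute_winning_targets (R : realType) (beta : R) (M : nat)
    (targets : move R -> move R -> seq R) (S : set R) :
  0 < beta -> beta <= 1 ->
  (forall p q t, t \in targets p q -> unit_itv t) ->
  (forall p q, (size (targets p q) < 2 ^ M)%N) ->
  S `<=` @unit_itv R ->
  (forall b x,
    (forall k, is_move (b k)) ->
    (forall k n, beta ^+ n * (b k).2 <= (b (k + n)%N).2) ->
    (forall k, ball01 (b k) x) -> irrational x ->
    (forall e, 0 < e -> exists N, forall k, (N <= k)%N -> (b k).2 < e) ->
    (forall w t, t \in targets (b (w * M.*2)%N) (b (w.+1 * M.*2)%N) ->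
      beta ^+ (4 * M).+1 * (b (w * M.*2)%N).2 < `|x - t|) ->
    S x) ->
  absolute_winning beta S.
Proof.
move=> b0 b1 tu ts Su HS; split=> //.
exists (alice_strategy beta M targets) => b; split.
  move=> k bk; apply: alice_strategy_legal => //.
  by case: (bk k (leqnn k)).
move=> bl.
have bm k : is_move (b k) by case: (bl k).
have [x [xb xirr xr]] := balls_avoiding_rationals bm
  (fun k y yb => (let: conj _ (conj h _) := bl k.+1 in h y yb).1)
  (play_avoids_rationals b0 bl).
exists x; split; first by move=> k _; exact: xb.
apply: (HS b x bm _ xb xirr xr).
  exact: play_radius bl.
move=> w t tw; exact: (play_avoids_targets b0 tu bl b1 ts xb tw).
Qed.

(** * Cylinders of an expanding map and the targets in them *)

Section Expansion.
Variables (R : realType) (T : R -> R).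

(** When [T] fixes 0 and takes values in [0,1), this says that the orbit has not met 0 up to time
    [n]. *)
Definition in_cylinder n x := 0 < x < 1 /\ 0 < iter n T x.

(* lo n x and hi n x are the end points of the open cylinder of rank n around x; the inverse branch
   of T^n on a cylinder contracts by a factor comparable to the length of that cylinder. *)
Record expanding_cylinders (C : R) (lo hi : nat -> R -> R) : Prop := {
  cylinder_mem : forall n x, in_cylinder n x -> lo n x < x < hi n x;
  cylinder_eq : forall n x y, in_cylinder n x -> lo n x < y < hi n x ->
    [/\ in_cylinder n y, lo n y = lo n x & hi n y = hi n x];
  cylinder_succ : forall n x, in_cylinder n.+1 x ->
    hi n.+1 x - lo n.+1 x <= hi n x - lo n x;
  cylinder_succ2 : forall n x, in_cylinder n.+2 x ->
    hi n.+2 x - lo n.+2 x <= 2^-1 * (hi n x - lo n x);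
  cylinder_distortion : forall n x y, in_cylinder n x -> lo n x < y < hi n x ->
    `|x - y| <= C * `|iter n T x - iter n T y| * (hi n x - lo n x)
}.

Hypothesis T_zero : T 0 = 0.
Hypothesis T_range : forall x, 0 <= T x < 1.

Lemma in_cylinder_le m n x : (m <= n)%N -> in_cylinder n x -> in_cylinder m x.
Proof.
move=> mn [x01 xn]; split=> //.
have [//|xm|xm] := ltrgtP 0 (iter m T x).
- have : 0 <= iter m T x.
    by case: (m) => [|k] /=; [case/andP: x01 => /ltW|case/andP: (T_range (iter k T x))].
  by rewrite leNgt xm.
- move: xn; rewrite -(subnK mn) iterD -xm.
  suff -> : iter (n - m) T 0 = 0 by rewrite ltxx.
  by elim: (n - m)%N => //= k ->.
Qed.

Section Cylinders.
Variables (C : R) (lo hi : nat -> R -> R).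
Hypothesis cyl : expanding_cylinders C lo hi.
Let len n x := hi n x - lo n x.

Lemma cylinder_length_decay m n x : in_cylinder (m + n) x ->
  len (m + n) x <= 2^-1 ^+ n./2 * len m x.
Proof.
elim/ltn_ind: n => -[|[|n]] IH xn.
- by rewrite addn0 mul1r.
- by rewrite addn1 mul1r; apply: (cylinder_succ cyl); rewrite -addn1.
- rewrite !addnS in xn *; apply: le_trans (cylinder_succ2 cyl xn) _.
  rewrite /= exprS -mulrA ler_pM2l ?invr_gt0//; apply: IH => //.
  by apply: in_cylinder_le xn; lia.
Qed.

(** From the least rank in the range, where the length is at most [2 * rho], [K.*2] further ranks
    bring it down to at most [2 * r]. *)
Lemma cylinder_ranks x (r rho : R) (K : nat) : 2^-1 ^+ K * rho <= r ->
  exists n0, forall n, in_cylinder n x -> 2 * r < len n x <= 2 * rho ->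
    (n0 <= n < n0 + K.*2)%N.
Proof.
move=> rK.
pose P n := `[< in_cylinder n x >] && (2 * r < len n x <= 2 * rho).
have [[n Pn]|nP] := pselect (exists n, P n); last first.
  by exists 0%N => n xn nr; case: nP; exists n; rewrite /P nr andbT; apply/asboolP.
have [m /andP[/asboolP xm /andP[mr mrho]] mmin] := ex_minnP (ex_intro _ n Pn).
exists m => k xk /andP[kr krho].
have mk : (m <= k)%N by apply: mmin; rewrite /P kr krho !andbT; apply/asboolP.
rewrite mk /= ltnNge; apply/negP => mKk.
have := @cylinder_length_decay m (k - m) x; rewrite subnKC// => /(_ xk).
apply/negP; rewrite -ltNge (le_lt_trans _ kr)//.
have lm0 : 0 <= len m x.
  by rewrite subr_ge0 ltW//; case/andP: (cylinder_mem cyl xm); exact: lt_trans.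
apply: (@le_trans _ _ (2^-1 ^+ K * len m x)).
  rewrite ler_wpM2r// ler_wiXn2l ?invr_ge0 ?invf_le1 ?ler1n//.
  by rewrite geq_half_double leq_subRL.
apply: le_trans (_ : 2^-1 ^+ K * (2 * rho) <= _).
  by rewrite ler_wpM2l// exprn_ge0// invr_ge0.
by rewrite mulrCA ler_pM2l.
Qed.

(* A cylinder longer than the ball that it meets contains an end point of the ball; the cylinders
   containing a given point form a chain of geometrically decreasing lengths. *)
Lemma targets_exist (bad : nat -> set R) (K : nat) (p q : move R) :
  exists s : seq R, [/\ (size s <= 2 * K.*2)%N,
    forall t, t \in s -> unit_itv t &
    2^-1 ^+ K * p.2 <= q.2 -> forall x n, ball01 q x -> in_cylinder n x -> bad n x ->
      2 * q.2 < len n x <= 2 * p.2 ->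
      exists2 t, t \in s & [/\ ball01 q t, bad n t & lo n x < t < hi n x]].
Proof.
have [pq|_] := boolP (2^-1 ^+ K * p.2 <= q.2); last by exists [::].
pose A e n : set R := [set t | [/\ ball01 q t, bad n t & lo n e < t < hi n e]].
have [n1 H1] := @cylinder_ranks (q.1 - q.2) _ _ _ pq.
have [n2 H2] := @cylinder_ranks (q.1 + q.2) _ _ _ pq.
(* One point per rank and per end point of the ball; [xget] falls back on 0, which is in [0,1], when
   the cylinder has no bad point in the ball. *)
pose s e m := [seq xget 0 (A e n) | n <- iota m K.*2].
exists (s (q.1 - q.2) n1 ++ s (q.1 + q.2) n2); split.
- by rewrite size_cat !size_map !size_iota mul2n addnn.
- have su e m t : t \in s e m -> unit_itv t.
    move=> /mapP[n _ ->]; case: xgetP => [y _ [[]]//|_].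
    by rewrite unit_itvE lexx ler01.
  by move=> t; rewrite mem_cat => /orP[] /su.
- move=> _ x n qx xn bx nlen.
  have key e m : lo n x < e < hi n x ->
      (forall n, in_cylinder n e -> 2 * q.2 < len n e <= 2 * p.2 -> (m <= n < m + K.*2)%N) ->
      exists2 t, t \in s e m & [/\ ball01 q t, bad n t & lo n x < t < hi n x].
    move=> xe He; have [en loE hiE] := cylinder_eq cyl xn xe.
    have xA : A e n x by split=> //; rewrite loE hiE; exact: (cylinder_mem cyl xn).
    exists (xget 0 (A e n)).
      by apply/mapP; exists n => //; rewrite mem_iota He// /len loE hiE.
    by have := xgetI 0 xA; rewrite /A/= loE hiE.
  have /andP[lox xhi] := cylinder_mem cyl xn.
  have [_] := qx; rewrite ler_norml => /andP[h1 h2].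
  (* A cylinder starting left of the ball contains its left end; otherwise, being longer than the
     ball, it extends past the right end. *)
  have [h|h] := ltP (lo n x) (q.1 - q.2).
    have [|t ts tP] := key (q.1 - q.2) n1 _ H1; first by rewrite h /=; lra.
    by exists t => //; rewrite mem_cat ts.
  have [|t ts tP] := key (q.1 + q.2) n2 _ H2.
    by move: nlen; rewrite /len => /andP[h3 _]; apply/andP; split; lra.
  by exists t => //; rewrite mem_cat ts orbT.
Qed.

End Cylinders.
End Expansion.

(** * Elementary estimates on limits and powers *)

Lemma limn_einf_gt0 (R : realType) (u : nat -> R) (e : R) (N : nat) : 0 < e ->
  (forall n, (N <= n)%N -> e <= u n) -> (0 < limn_einf (fun n => (u n)%:E))%E.
Proof.
move=> e0 eu; rewrite limn_einf_lim; apply: (@lt_le_trans _ _ e%:E).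
  by rewrite lte_fin.
apply: lime_ge; first exact: is_cvg_einfs.
exists N => // n /= Nn; apply: le_ereal_inf_tmp => _ [k /= nk <-].
by rewrite lee_fin eu// (leq_trans Nn).
Qed.

(** Fixes the window length: the number of targets is linear in M, while M halvings handle
    exponentially many. *)
Lemma exists_mul_ltn_expn2 (c : nat) : exists2 M, (0 < M)%N & (M * c < 2 ^ M)%N.
Proof.
have h n : (2 * n < 4 ^ n)%N.
  elim: n => // n IH; rewrite expnS mulnS.
  by have := expn_gt0 4 n; move: IH; set a := (4 ^ n)%N; lia.
exists (4 * c).+1 => //; rewrite mulSn expnS.
rewrite (_ : (2 ^ (4 * c) = 4 ^ c * 4 ^ c)%N); last by rewrite expnM -expnMn.
by have := h c; set a := (4 ^ c)%N; nia.
Qed.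

Lemma expr_half_le (R : realType) (e : R) : 0 < e -> exists n, 2^-1 ^+ n <= e.
Proof.
move=> e0; exists (Num.bound e^-1).
have h : e^-1 < (Num.bound e^-1)%:R by apply: archi_boundP; rewrite invr_ge0 ltW.
rewrite exprVn -[leRHS]invrK lef_pV2 ?posrE ?invr_gt0 ?exprn_gt0//.
by rewrite (le_trans (ltW h))// -natrX ler_nat ltnW// ltn_expl.
Qed.

(** * The winning property for maps with expanding cylinders *)

Lemma BA_absolute_winning (R : realType) (T : R -> R) (C : R) (lo hi : nat -> R -> R)
    (f : nat -> R -> R) (beta : R) :
  T 0 = 0 -> (forall x, 0 <= T x < 1) ->
  (forall x, irrational x -> irrational (T x)) ->
  0 < C -> expanding_cylinders T C lo hi ->
  equicontinuous_unit_itv f -> 0 < beta -> beta <= 1 ->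
  absolute_winning beta (BA T f).
Proof.
move=> T0 Trange Tirr C0 cyl fe b0 b1.
have [d db] := expr_half_le b0.
(* A window has at most 8Md targets: two end points with 2K ranks each, where K = 2Md. *)
have [M M0 HM] := exists_mul_ltn_expn2 (8 * d)%N.
(* One window multiplies the radius by at least [beta ^+ M.*2], hence by at least [2^-1 ^+ K]. *)
pose K := (M.*2 * d)%N.
(* In 6C, C comes from the distortion, 3 from a triangle inequality and 2 from
   [len n <= 2 * r w]. *)
pose e := beta ^+ (4 * M).+1 / (6 * C).
have e0 : 0 < e by rewrite divr_gt0 ?exprn_gt0 ?mulr_gt0.
pose bad n : set R := [set x | `|iter n T x - f n x| < e].
have /choice[tg Htg] : forall pq : move R * move R, _ :=
  fun pq => targets_exist T0 Trange cyl bad K pq.1 pq.2.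
apply: (@absolute_winning_targets _ _ M (fun p q => tg (p, q))) => //.
- by move=> p q t; have [_ + _] := Htg (p, q); apply.
- move=> p q; have [+ _ _] := Htg (p, q); move=> /leq_ltn_trans; apply.
  by apply: leq_trans HM; rewrite ltnS /K -!muln2; lia.
- by move=> x [].
move=> b x bm brad xb xirr bto0 bavoid.
have x01 : unit_itv x by case: (xb 0%N).
(* Irrational iterates never meet 0, so [x] lies in a cylinder of every rank. *)
have iter_irr n : irrational (iter n T x).
  by elim: n => //= n; exact: Tirr.
have irr0 (y : R) : irrational y -> 0 <= y -> 0 < y.
  move=> yirr; rewrite le_eqVlt => /orP[/eqP y0|//].
  by case: yirr; exists 0 => //; rewrite rmorph0.
have xin n : in_cylinder T n x.
  move: x01; rewrite unit_itvE => /andP[x0 x1]; split.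
    rewrite irr0//= lt_neqAle x1 andbT; apply/eqP => xE.
    by apply: xirr; exists 1 => //; rewrite rmorph1.
  apply: irr0 => //; case: n => [|n] //=.
  by case/andP: (Trange (iter n T x)).
pose len n := hi n x - lo n x.
have len_gt0 n : 0 < len n.
  by rewrite subr_gt0; case/andP: (cylinder_mem cyl (xin n)); exact: lt_trans.
have [delta delta0 Hdelta] := fe x e x01 e0.
have d2 : 0 < delta / 2 by rewrite divr_gt0.
(* From window N on, the points of a ball are within [delta] of [x], so equicontinuity applies. *)
have [N HN] := bto0 _ d2.
pose r w := (b (w * M.*2)%N).2.
have rN w : (N <= w)%N -> r w < delta / 2.
  by move=> Nw; apply: HN; rewrite (leq_trans Nw)// leq_pmulr// double_gt0.
have r0 w : 0 < r w by case: (bm (w * M.*2)%N).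
(* From rank [j.*2] on, cylinders around [x] are short enough to be treated in a window after N. *)
have [j Hj] : exists j, 2^-1 ^+ j <= 2 * r N / len 0%N.
  by apply: expr_half_le; rewrite divr_gt0// mulr_gt0.
split=> //; apply: (@limn_einf_gt0 _ _ e (maxn 1 j.*2)) => // n.
rewrite geq_max => /andP[n0 jn]; rewrite leNgt; apply/negP => xbad.
have lenN : len n <= 2 * r N.
  have := @cylinder_length_decay _ _ T0 Trange _ _ _ cyl 0 n x (xin n).
  rewrite add0n -/(len n) -/(len 0%N) => /le_trans; apply.
  rewrite -ler_pdivlMr//; apply: le_trans Hj.
  by rewrite ler_wiXn2l ?invr_ge0 ?invf_le1 ?ler1n// geq_half_double.
(* The least such [w] is the window treating the cylinder. It is not N itself, so its predecessor
   gives the upper bound on [len n]. *)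
pose P w := (N <= w)%N && (2 * r w < len n).
have exP : exists w, P w.
  have l2 : 0 < len n / 2 by rewrite divr_gt0.
  have [N' HN'] := bto0 _ l2.
  exists (maxn N N'); rewrite /P leq_maxl /=.
  suff : r (maxn N N') < len n / 2 by lra.
  apply: HN'; apply: leq_trans (leq_maxr N N') _.
  by rewrite leq_pmulr// double_gt0.
have [w /andP[Nw rw] wmin] := ex_minnP exP.
case: w Nw rw wmin => [|w] Nw rw wmin.
  by move: Nw rw lenN; rewrite leqn0 => /eqP -> h1 h2; lra.
have {}Nw : (N <= w)%N.
  rewrite leqNgt; apply/negP => wN.
  have NE : N = w.+1 by apply/eqP; rewrite eqn_leq Nw.
  by move: rw lenN; rewrite -NE => h1 h2; lra.
have lenw : len n <= 2 * r w.
  rewrite leNgt; apply/negP => h.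
  by have := wmin w; rewrite /P Nw h ltnn => /(_ isT).
have [_ tu] := Htg (b (w * M.*2)%N, b (w.+1 * M.*2)%N).
move=> /(_ _ x n (xb _) (xin n) xbad)[].
- rewrite /= mulSn addnC; apply: le_trans (brad _ _).
  rewrite ler_pM2r; last exact: r0.
  rewrite /K mulnC exprM lerXn2r// ?nnegrE ?exprn_ge0 ?invr_ge0//; exact: ltW.
- by rewrite rw lenw.
move=> t tin [tb tbad tcyl].
have /= := bavoid _ _ tin; apply/negP; rewrite -leNgt.
have xt : `|x - t| < delta.
  have [_ h1] := xb (w * M.*2)%N; have [_ h2] := xb (w.+1 * M.*2)%N.
  have [_ /= h3] := tb; have := rN w.+1 (leqW Nw); rewrite /r => h4.
  move: h2 h3; rewrite !ler_norml ltr_norml => /andP[? ?] /andP[? ?].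
  by apply/andP; split; lra.
have ft : `|f n x - f n t| < e by apply: Hdelta => //; case: tb.
(* Both [x] and [t] are bad: pass through [f n x] and [f n t]. *)
have Tt : `|iter n T x - iter n T t| <= 3 * e.
  move: xbad tbad ft; rewrite /bad /= !ltr_norml ler_norml.
  move=> /andP[? ?] /andP[? ?] /andP[? ?]; apply/andP; split; lra.
apply: le_trans (cylinder_distortion cyl (xin n) tcyl) _.
apply: (@le_trans _ _ (C * (3 * e) * (2 * r w))).
  apply: ler_pM => //; first by rewrite mulr_ge0// ltW.
    exact: ltW (len_gt0 n).
  by rewrite ler_pM2l.
rewrite /e le_eqVlt; apply/orP; left; apply/eqP.
by rewrite /r; field; rewrite gt_eqF.
Qed.

(** * Fractional parts and irrationality *)

Section FracPart.
Variable R : realType.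
Implicit Types (x y : R) (m : int).

Lemma frac_part_range x : 0 <= frac_part x < 1.
Proof.
by have /andP[h1 h2] := floor_itv x; rewrite /frac_part subr_ge0 h1 ltrBlDl -intrD1.
Qed.

Lemma frac_partDz x m : frac_part (x + m%:~R) = frac_part x.
Proof.
rewrite /frac_part floorDrz ?intr_int// intrKfloor intrD; ring.
Qed.

Lemma frac_part_id x : 0 <= x < 1 -> frac_part x = x.
Proof.
by move=> x01; rewrite /frac_part (_ : Num.floor x = 0) ?subr0//; apply: floor_def.
Qed.

Lemma frac_part_gt0_floor x : 0 < frac_part x ->
  (Num.floor x)%:~R < x < (Num.floor x + 1)%:~R.
Proof. by rewrite /frac_part subr_gt0 => ->; case/andP: (floor_itv x). Qed.

Lemma irrational_frac_part x : irrational x -> irrational (frac_part x).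
Proof.
move=> xi [q _ qx]; apply: xi; exists (q + (Num.floor x)%:~R) => //.
by rewrite rmorphD /= ratr_int qx /frac_part subrK.
Qed.

Lemma irrational_inv x : irrational x -> irrational x^-1.
Proof.
move=> xi [q _ qx]; apply: xi; exists q^-1 => //.
by rewrite fmorphV /= qx invrK.
Qed.

Lemma irrational_natMl (n : nat) x : (0 < n)%N -> irrational x ->
  irrational (n%:R * x).
Proof.
move=> n0 xi [q _ qx]; apply: xi; exists (n%:R^-1 * q) => //.
by rewrite rmorphM /= fmorphV /= ratr_nat qx mulKf// pnatr_eq0 -lt0n.
Qed.

End FracPart.

(** * Multiplication by gamma modulo 1 *)

Section TimesMap.
Variables (R : realType) (gamma : nat).
Hypothesis gamma_gt1 : (1 < gamma)%N.
Let T : R -> R := @times_map R gamma.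
Let g n : R := gamma%:R ^+ n.

Let g_gt0 n : 0 < g n.
Proof. by rewrite exprn_gt0// ltr0n ltnW. Qed.

Lemma iter_times_map n x : 0 <= x < 1 -> iter n T x = frac_part (g n * x).
Proof.
move=> x01; elim: n => [|n IH]; first by rewrite /g mul1r frac_part_id.
rewrite /= IH /T /times_map {1}/frac_part mulrBr.
rewrite /g exprS -mulrA -/(g n).
rewrite -[RHS](frac_partDz _ (- (gamma%:Z * Num.floor (g n * x)))).
by rewrite intrN intrM.
Qed.

(** The cylinders of rank [n] are the gamma-adic intervals of length gamma^-n. *)
Definition times_lo n (x : R) : R := (Num.floor (gamma%:R ^+ n * x))%:~R / gamma%:R ^+ n.
Definition times_hi n (x : R) : R := times_lo n x + (gamma%:R ^+ n)^-1.

Lemma times_cylinderE n x y : (times_lo n x < y < times_hi n x) =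
  ((Num.floor (g n * x))%:~R < g n * y < (Num.floor (g n * x) + 1)%:~R).
Proof.
rewrite /times_hi /times_lo -/(g n) ltr_pdivrMr// -[X in _ + X]mul1r -mulrDl.
by rewrite ltr_pdivlMr// -intrD1 [y * _]mulrC.
Qed.

(** The distortion constant is 1 because the n-th iterate is affine of slope gamma^n on each
    cylinder. *)
Lemma times_map_cylinders :
  expanding_cylinders T 1 times_lo times_hi.
Proof.
have lenE n x : times_hi n x - times_lo n x = (g n)^-1.
  by rewrite /times_hi addrC addKr.
have gamma2 : 2 <= gamma%:R :> R by rewrite ler_nat.
have gV n : 0 < (g n)^-1 by rewrite invr_gt0.
have gS n : (g n.+1)^-1 <= 2^-1 * (g n)^-1.
  rewrite /g exprS invfM ler_pM2r ?gV// lef_pV2 ?posrE//.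
  by rewrite ltr0n ltnW.
have mem n x : in_cylinder T n x -> times_lo n x < x < times_hi n x.
  move=> [/andP[x0 x1]]; rewrite iter_times_map ?ltW//= => xn.
  by rewrite times_cylinderE; exact: frac_part_gt0_floor.
have eq n x y : in_cylinder T n x -> times_lo n x < y < times_hi n x ->
    0 < y < 1 /\ Num.floor (g n * y) = Num.floor (g n * x).
  move=> xn; rewrite times_cylinderE => /andP[y1 y2].
  have [/andP[x0 x1] _] := xn.
  (* These bounds keep the whole gamma-adic interval inside [0,1]. *)
  have f0 : 0 <= Num.floor (g n * x) by rewrite floor_ge_int mulr_ge0// ltW.
  have f1 : Num.floor (g n * x) + 1 <= (gamma ^ n)%:Z.
    rewrite lezD1 floor_lt_int -pmulrn natrX -/(g n) -[ltRHS]mulr1 ltr_pM2l//.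
  split; last by apply: floor_def; rewrite ltW.
  apply/andP; split.
    by rewrite -(pmulr_rgt0 _ (g_gt0 n)) (le_lt_trans _ y1)// ler0z.
  rewrite -(ltr_pM2l (g_gt0 n)) mulr1 (lt_le_trans y2)//.
  by rewrite (_ : g n = (gamma ^ n)%:Z%:~R) ?ler_int// -pmulrn natrX.
split=> //.
- move=> n x y xn yn; have [y01 fE] := eq _ _ _ xn yn.
  have lE : times_lo n y = times_lo n x by rewrite /times_lo -/(g n) fE.
  have hE : times_hi n y = times_hi n x by rewrite /times_hi lE.
  split=> //; split=> //; rewrite iter_times_map; last by case/andP: y01 => /ltW -> ->.
  by move: yn; rewrite times_cylinderE -fE /frac_part subr_gt0 => /andP[].
- move=> n x _; rewrite !lenE (le_trans (gS n))//.
  by rewrite ler_piMl ?ltW// invf_lt1 ?ltr1n.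
- move=> n x _; rewrite !lenE (le_trans (gS _))// ler_pM2l ?invr_gt0//.
  rewrite (le_trans (gS n))//.
  by rewrite ler_piMl ?ltW// invf_lt1 ?ltr1n.
- move=> n x y xn yn; have [y01 fE] := eq _ _ _ xn yn; have [x01 _] := xn.
  have w z : 0 < z < 1 -> 0 <= z < 1 by case/andP => /ltW -> ->.
  rewrite lenE mul1r !iter_times_map ?w// /frac_part fE.
  rewrite [X in _ <= `|X| * _](_ : _ = g n * (x - y)); last by ring.
  by rewrite normrM (gtr0_norm (g_gt0 n)) mulrC mulKf// gt_eqF.
Qed.

End TimesMap.

(** * The Gauss map and continued fractions *)

Section GaussMap.
Variable R : realType.
Let T : R -> R := @gauss_map R.
Implicit Types (x y t k : R).

(* (p, p', q, q') stands for the map t |-> (p + p' t) / (q + q' t), the inverse branch of T^n on the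
   cylinder of x: p/q and p'/q' are two successive convergents of x. *)
Record branch := Branch { bp : R; bp' : R; bq : R; bq' : R }.

Definition branch_fun (M : branch) t := (bp M + bp' M * t) / (bq M + bq' M * t).

Fixpoint gauss_branch n x : branch :=
  if n is m.+1 then
    let M := gauss_branch m x in
    let k := (Num.floor (iter m T x)^-1)%:~R in
    Branch (bp M * k + bp' M) (bp M) (bq M * k + bq' M) (bq M)
  else Branch 0 1 1 0.

Definition branch_det M := bp' M * bq M - bp M * bq' M.

(** Invariants of the recurrence for convergents. They keep q + q' t between q and 2q for t in
    [0,1], whence the bounded distortion. *)
Definition good_branch M :=
  [/\ 1 <= bq M, 0 <= bq' M <= bq M & branch_det M = 1 \/ branch_det M = -1].

Lemma gauss_map_itv x : 0 < x < 1 -> 0 < T x ->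
  exists2 k, 1 <= k & k = (Num.floor x^-1)%:~R /\ x = (k + T x)^-1.
Proof.
move=> /andP[x0 x1] Tx.
exists (Num.floor x^-1)%:~R.
  by rewrite ler1z floor_ge_int invf_ge1// ltW.
split=> //; rewrite /T /gauss_map gt_eqF// /frac_part addrC subrK invrK //.
Qed.

Lemma gauss_mapV k t : (exists m : int, k = m%:~R) -> 1 <= k -> 0 < t < 1 ->
  (Num.floor (k + t))%:~R = k /\ T (k + t)^-1 = t.
Proof.
move=> [m ->] k1 /andP[t0 t1].
have fE : Num.floor (m%:~R + t) = m.
  by apply: floor_def; rewrite intrD1 lerDl ltW//= ltrD2l.
rewrite fE; split=> //.
rewrite /T /gauss_map invr_eq0 gt_eqF; last first.
  by rewrite (lt_le_trans ltr01)// (le_trans k1)// lerDl ltW.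
by rewrite invrK /frac_part fE addrAC subrr add0r.
Qed.

Lemma gauss_map0 : T 0 = 0.
Proof. by rewrite /T /gauss_map eqxx. Qed.

Lemma gauss_map_range x : 0 <= T x < 1.
Proof.
by rewrite /T /gauss_map; case: ifP => _; [rewrite lexx ltr01|exact: frac_part_range].
Qed.

Lemma iter_gauss_in_cylinder n x : in_cylinder T n x -> 0 < iter n T x < 1.
Proof.
move=> [x01 xn]; rewrite xn; case: n {xn} => [|n] /=; first by case/andP: x01.
by case/andP: (gauss_map_range (iter n T x)).
Qed.

Let child M k := Branch (bp M * k + bp' M) (bp M) (bq M * k + bq' M) (bq M).

Lemma good_branch_child M k : good_branch M -> 1 <= k -> good_branch (child M k).
Proof.
move=> [q1 q'0 dM] k1; split => /=.
- by nra.
- by apply/andP; split; nra.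
- rewrite (_ : branch_det _ = - branch_det M); last by rewrite /branch_det /=; ring.
  by case: dM => ->; [right|left; rewrite opprK].
Qed.

Lemma branch_denom_gt0 M t : good_branch M -> 0 <= t -> 0 < bq M + bq' M * t.
Proof. by move=> [q1 /andP[q'0 _] _] t0; nra. Qed.

(** Appending the digit [k] composes the branch with the inverse branch t -> 1/(k + t). *)
Lemma branch_fun_child M k t : good_branch M -> 1 <= k -> 0 < t ->
  branch_fun (child M k) t = branch_fun M (k + t)^-1.
Proof.
move=> gM k1 t0; have kt : 0 < k + t by lra.
have := @branch_denom_gt0 M (k + t)^-1 gM; rewrite invr_ge0 (ltW kt) => /(_ isT) d0.
have := @branch_denom_gt0 _ t (good_branch_child gM k1) (ltW t0) => /= d1.
rewrite /branch_fun /=; field.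
rewrite !gt_eqF//=; last first.
all: by rewrite -?addrA; move: d1; rewrite -?mulrDr; nra.
Qed.

Lemma branch_funB M s t : good_branch M -> 0 <= s -> 0 <= t ->
  branch_fun M t - branch_fun M s =
  branch_det M * (t - s) / ((bq M + bq' M * t) * (bq M + bq' M * s)).
Proof.
move=> gM s0 t0; rewrite /branch_fun /branch_det; field.
by rewrite !gt_eqF ?branch_denom_gt0.
Qed.

(** The branch increases or decreases with the sign of its determinant, so the order of the two end
    values varies. *)
Definition branch_lo M := Num.min (branch_fun M 0) (branch_fun M 1).
Definition branch_hi M := Num.max (branch_fun M 0) (branch_fun M 1).

Lemma branch_length M : good_branch M ->
  branch_hi M - branch_lo M = (bq M * (bq M + bq' M))^-1.
Proof.
move=> gM; have := branch_funB gM (lexx 0) ler01.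
have /andP[q0 qq0] : (0 < bq M) && (0 < bq M + bq' M).
  by case: gM => q1 /andP[q'0 _] _; apply/andP; split; lra.
have D0 : 0 < (bq M * (bq M + bq' M))^-1 by rewrite invr_gt0 mulr_gt0.
rewrite mulr1 mulr0 addr0 subr0 mulr1 [X in _ / X]mulrC /branch_hi /branch_lo.
case: gM => _ _ [] -> E.
  have F01 : branch_fun M 0 <= branch_fun M 1 by rewrite -subr_ge0 E mul1r ltW.
  by rewrite (max_r F01) (min_l F01) E mul1r.
have F10 : branch_fun M 1 <= branch_fun M 0 by rewrite -subr_le0 E mulN1r oppr_le0 ltW.
by rewrite (max_l F10) (min_r F10) -opprB E mulN1r opprK.
Qed.

Lemma branch_itvP M y : good_branch M ->
  (branch_lo M < y < branch_hi M) <-> exists2 t, 0 < t < 1 & y = branch_fun M t.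
Proof.
move=> gM; have [q1 /andP[q'0 _] dM] := gM.
have q0 : 0 < bq M by lra.
have qq0 : 0 < bq M + bq' M by lra.
rewrite /branch_lo /branch_hi; split.
  move=> yM.
  (* Clearing denominators in [y = branch_fun M t] gives an equation linear in [t]. *)
  have [t t01 ty] : exists2 t, 0 < t < 1 & t * (bp' M - bq' M * y) = bq M * y - bp M.
    have F0 : branch_fun M 0 = bp M / bq M by rewrite /branch_fun !mulr0 !addr0.
    have F1 : branch_fun M 1 = (bp M + bp' M) / (bq M + bq' M) by rewrite /branch_fun !mulr1.
    have [[h1 h2]|[h1 h2]] : (branch_fun M 0 < y /\ y < branch_fun M 1) \/
        (branch_fun M 1 < y /\ y < branch_fun M 0).
      move: yM; rewrite gt_min lt_max => /andP[/orP[a|a] /orP[b|b]];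
        by [left|right|have := lt_trans a b; rewrite ltxx].
    - move: h1 h2; rewrite F0 F1 ltr_pdivrMr// ltr_pdivlMr// => h1 h2.
      have D0 : 0 < bp' M - bq' M * y by lra.
      exists ((bq M * y - bp M) / (bp' M - bq' M * y)).
        by rewrite divr_gt0 ?ltr_pdivrMr// ?mul1r; lra.
      by rewrite divfK// gt_eqF.
    - move: h1 h2; rewrite F0 F1 ltr_pdivrMr// ltr_pdivlMr// => h1 h2.
      have D0 : 0 < bq' M * y - bp' M by lra.
      exists ((bp M - bq M * y) / (bq' M * y - bp' M)).
        by rewrite divr_gt0 ?ltr_pdivrMr// ?mul1r; lra.
      by rewrite -[bp' M - _]opprB mulrN divfK ?gt_eqF// opprB.
  exists t => //; have /andP[/ltW t0 _] := t01.
  by apply: (canRL (mulfK (lt0r_neq0 (branch_denom_gt0 gM t0)))); lra.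
move=> [t /andP[t0 t1] ->].
have d0 := branch_denom_gt0 gM (ltW t0).
have h0 := branch_funB gM (lexx 0) (ltW t0).
have h1 := branch_funB gM (ltW t0) ler01.
have e0 : 0 < (t - 0) / ((bq M + bq' M * t) * (bq M + bq' M * 0)).
  by rewrite subr0 divr_gt0// mulr_gt0// branch_denom_gt0.
have e1 : 0 < (1 - t) / ((bq M + bq' M * 1) * (bq M + bq' M * t)).
  by rewrite divr_gt0 ?subr_gt0// mulr_gt0// branch_denom_gt0.
(* The increments from 0 to [t] and from [t] to 1 both have the sign of the determinant. *)
move: h0 h1; rewrite -!mulrA; set a := (t - 0) / _ in e0 *; set b := (1 - t) / _ in e1 *.
rewrite gt_min lt_max; case: dM => -> h0 h1; apply/andP; split; apply/orP.
- by left; lra.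
- by right; lra.
- by right; lra.
- by left; lra.
Qed.

Lemma gauss_branchP n x : in_cylinder T n x ->
  good_branch (gauss_branch n x) /\ x = branch_fun (gauss_branch n x) (iter n T x).
Proof.
elim: n => [|n IH] xn.
  split; last by rewrite /branch_fun /= mul0r mul1r addr0 add0r divr1.
  by split=> /=; rewrite /branch_det /=; [|apply/andP; split|left]; lra.
have xn' := in_cylinder_le gauss_map0 gauss_map_range (leqnSn n) xn.
have [gM xM] := IH xn'.
have [k k1 [kE xk]] := gauss_map_itv (iter_gauss_in_cylinder xn') xn.2.
have gC := good_branch_child gM k1.
have -> : gauss_branch n.+1 x = child (gauss_branch n x) k by rewrite /= -kE.
split=> //; rewrite branch_fun_child//; last exact: xn.2.
by rewrite /= -xk.
Qed.

(** Induction on the last digit: removing [k] turns the tail [t] into [(k + t)^-1], still in (0,1),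
    and applying [T] recovers [k] and [t]. *)
Lemma gauss_branch_eq n x t : in_cylinder T n x -> 0 < t < 1 ->
  let y := branch_fun (gauss_branch n x) t in
  [/\ 0 < y < 1, iter n T y = t & gauss_branch n y = gauss_branch n x].
Proof.
elim: n t => [|n IH] t xn t01 /=.
  by rewrite /branch_fun /= mul0r mul1r addr0 add0r divr1.
have xn' := in_cylinder_le gauss_map0 gauss_map_range (leqnSn n) xn.
have [gM xM] := gauss_branchP xn'.
have [k k1 [kE xk]] := gauss_map_itv (iter_gauss_in_cylinder xn') xn.2.
rewrite -/(child _ _) -kE branch_fun_child//; last by case/andP: t01.
have kt01 : 0 < (k + t)^-1 < 1.
  have /andP[t0 t1] := t01.
  by rewrite invr_gt0 invf_lt1; [apply/andP; split; lra|lra].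
have [y01 Ty My] := IH _ xn' kt01.
have [kt Tkt] := @gauss_mapV k t (ex_intro _ _ kE) k1 t01.
by rewrite Ty My invrK kt Tkt.
Qed.

(** The constant is 2: the branch contracts by at most 1/q^2, and the length 1/(q(q + q')) is at
    least 1/(2q^2) as q' <= q. *)
Lemma gauss_map_cylinders : expanding_cylinders T 2
  (fun n x => branch_lo (gauss_branch n x)) (fun n x => branch_hi (gauss_branch n x)).
Proof.
have step n x : in_cylinder T n.+1 x -> [/\ good_branch (gauss_branch n x),
    bq' (gauss_branch n.+1 x) = bq (gauss_branch n x),
    bq (gauss_branch n x) + bq' (gauss_branch n x) <= bq (gauss_branch n.+1 x) &
    good_branch (gauss_branch n.+1 x)].
  move=> xn; have [gC _] := gauss_branchP xn.
  have xn' := in_cylinder_le gauss_map0 gauss_map_range (leqnSn n) xn.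
  have [gM xM] := gauss_branchP xn'.
  have [k k1 [kE xk]] := gauss_map_itv (iter_gauss_in_cylinder xn') xn.2.
  split=> //=; rewrite -kE lerD2r ler_peMr//.
  by case: gM => q1 _ _; exact: le_trans ler01 q1.
split.
- move=> n x xn; have [gM xM] := gauss_branchP xn.
  apply/(branch_itvP _ gM); exists (iter n T x) => //.
  exact: iter_gauss_in_cylinder.
- move=> n x y xn; have [gM xM] := gauss_branchP xn.
  move=> /(branch_itvP _ gM)[t t01 ->].
  have [y01 Ty ->] := gauss_branch_eq xn t01.
  by split=> //; split=> //; rewrite Ty; case/andP: t01.
- move=> n x /step[gM q'E qle gC].
  rewrite !branch_length// q'E; have [q1 /andP[q'0 _] _] := gM.
  by rewrite lef_pV2 ?posrE; nra.
(* The next denominators satisfy Q1 >= q + q' and Q2 >= Q1 + q, so Q2(Q2 + Q1) >= 2q(q + q'). *)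
- move=> n x xn; have [_ q'E2 qle2 gC] := step _ _ xn.
  have [gM q'E qle _] := step _ _ (in_cylinder_le gauss_map0 gauss_map_range (leqnSn _) xn).
  rewrite !branch_length// -invfM q'E2; have [q1 /andP[q'0 _] _] := gM.
  rewrite q'E in qle2.
  by rewrite lef_pV2 ?posrE; nra.
- move=> n x y xn; have [gM xM] := gauss_branchP xn.
  move=> /(branch_itvP _ gM)[t t01 yE].
  have [y01 Ty _] := gauss_branch_eq xn t01; rewrite -yE in Ty.
  have /andP[s0 _] := iter_gauss_in_cylinder xn; have /andP[t0 _] := t01.
  rewrite Ty {1}xM yE (branch_funB gM (ltW t0) (ltW s0)) branch_length//.
  set s := iter n T x in s0 *.
  have nd : `|branch_det (gauss_branch n x)| = 1.
    by case: gM => _ _ [] ->; rewrite ?normrN normr1.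
  have [q1 /andP[q'0 q'q] _] := gM.
  rewrite !normrM nd mul1r [2 * _]mulrC -mulrA ler_wpM2l// normfV gtr0_norm; last first.
    by rewrite mulr_gt0 ?branch_denom_gt0// ltW.
  rewrite -invf_div lef_pV2 ?posrE.
  + set q := bq _ in q1 q'q *; set q' := bq' _ in q'0 q'q *.
    apply: (@le_trans _ _ (q * q)); first by rewrite ler_pdivrMr//; nra.
    by apply: ler_pM; [lra|lra| |]; rewrite lerDl mulr_ge0// ltW.
  + by rewrite mulr_gt0 ?branch_denom_gt0// ltW.
  + by rewrite divr_gt0// mulr_gt0//; lra.
Qed.

End GaussMap.

(** * Application to the two systems *)

Theorem theorem4 (R : realType) (T : R -> R)
    (hT : (exists2 gamma : nat, (1 < gamma)%N & T = @times_map R gamma) \/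
          T = @gauss_map R)
    (f : nat -> R -> R) (hf : maps_unit_itv f)
    (hfe : equicontinuous_unit_itv f)
    (beta : R) (hbeta0 : 0 < beta) (hbeta1 : beta < 3%:R^-1) :
  absolute_winning beta (BA T f).
Proof.
have beta_le1 : beta <= 1 by lra.
case: hT => [[gamma gamma_gt1 ->]|->].
  apply: BA_absolute_winning (times_map_cylinders R gamma_gt1) hfe hbeta0 beta_le1 => //.
  - by rewrite /times_map mulr0 frac_part_id// lexx ltr01.
  - by move=> x; exact: frac_part_range.
  - by move=> x xi; apply/irrational_frac_part/irrational_natMl => //; exact: ltnW.
apply: BA_absolute_winning (gauss_map_cylinders R) hfe hbeta0 beta_le1 => //.
- exact: gauss_map0.
- exact: gauss_map_range.
- move=> x xi; rewrite /gauss_map; case: eqP => [x0|_].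
    by case: xi; exists 0 => //; rewrite rmorph0 x0.
  exact/irrational_frac_part/irrational_inv.
Qed.
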